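(* Let $m\ge 3$ and let $n$ be a natural number. For each fixed $m$-tuple $\Lambda$ of distinct complex numbers, $|\mathcal{D}_n(\Lambda)|\le\sum_{i=0}^n\binom{mn}{i}$, and moreover $\sum_{i=0}^n\binom{mn}{i}\le 2^{mnH(1/m)}$.
   Context: For a polynomial $P\in\mathbb{C}[x]$ of degree $n$ and an $m$-tuple $\Lambda=(\lambda_1,\dots,\lambda_m)$ of distinct complex numbers, the dope matrix of $P$ with respect to $\Lambda$ is the $m\times(n+1)$ matrix $D_P(\Lambda)=(\delta_{ij})_{i\in[1,m],\,j\in[0,n]}$, where $\delta_{ij}=1$ if $P^{(j)}(\lambda_i)=0$ and $\delta_{ij}=0$ otherwise ($P^{(j)}$ denotes the $j$-th derivative). $\mathcal{D}_n(\Lambda)=\{D_P(\Lambda):P\in\mathbb{C}[x],\ \deg P=n\}$. For $0<p<1$, $H(p)=-p\log_2 p-(1-p)\log_2(1-p)$ is the binary entropy function. *)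

(* Defs.v *)
From mathcomp Require Import all_boot all_order all_algebra.
From mathcomp Require Import boolp classical_sets reals exp.
From mathcomp Require Import complex.

Set Implicit Arguments.
Unset Strict Implicit.
Unset Printing Implicit Defensive.

Import Order.TTheory GRing.Theory Num.Theory.

Local Open Scope ring_scope.
Local Open Scope complex_scope.

(* The 0/1 entries are booleans, so that the dope matrices of a given size
   form a finType. The complex numbers are R[i] for R : realType. *)
Definition dope_matrix (R : realType) (m n : nat) (P : {poly R[i]})
    (Lambda : m.-tuple R[i]) : 'M[bool]_(m, n.+1) :=
  \matrix_(i < m, j < n.+1) ((P^`(j)).[tnth Lambda i] == 0).

(* deg P = n is size P = n.+1; this excludes P = 0 also for n = 0. *)
Definition dope_matrices (R : realType) (m n : nat) (Lambda : m.-tuple R[i]) :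
    {set 'M[bool]_(m, n.+1)} :=
  [set D | `[< exists P : {poly R[i]},
                 size P = n.+1 /\ D = dope_matrix n P Lambda >]].

Definition log2 (R : realType) (x : R) : R := ln x / ln 2.

Definition binary_entropy (R : realType) (p : R) : R :=
  - p * log2 p - (1 - p) * log2 (1 - p).

(* Main.v *)
Require Import Defs.
From mathcomp Require Import all_boot all_order all_algebra.
From mathcomp Require Import boolp classical_sets reals exp.
From mathcomp Require Import complex.
From mathcomp Require Import sequences ring lra.

Import Order.TTheory GRing.Theory Num.Theory.

Local Open Scope ring_scope.
Local Open Scope complex_scope.

(** The entries of a dope matrix outside the last column record the vanishing
    of mn linear forms at the coefficient vector of P, a nonzero vector of
    dimension n+1; the last column is identically 0. The set Z of forms
    vanishing at a vector consists of all the forms lying in the span of Z,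
    hence it is determined by any basis of this span extracted from Z. Such a
    basis has at most n elements since all of Z kills a nonzero vector. The
    entropy bound compares each term of the binomial expansion of
    (p + (1 - p))^(mn) = 1, where p = 1/m <= 1 - p, with p^n (1 - p)^(mn - n). *)

Lemma card_subsets_leq (T : finType) (n : nat) :
  #|[set B : {set T} | #|B| <= n]%N| = (\sum_(0 <= i < n.+1) 'C(#|T|, i))%N.
Proof.
elim: n => [|n IHn].
  rewrite big_nat1 bin0 -(cards1 (@finset.set0 T)).
  by apply: eq_card => B; rewrite !inE leqn0 cards_eq0.
rewrite big_nat_recr //= -IHn -card_draws -cardsUI.
rewrite [X in (_ = _ + X)%N]eq_card0 ?addn0; last first.
  by move=> B; rewrite !inE; case: eqP => [->|]; rewrite ?ltnn ?andbF.
by apply: eq_card => B; rewrite !inE leq_eqVlt ltnS orbC.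
Qed.

Definition zero_pattern {F : fieldType} {T : finType} {n : nat}
    (a : T -> 'rV[F]_n.+1) (u : 'cV[F]_n.+1) : {set T} :=
  [set t | a t *m u == 0].

(** Indices outside [B] get a zero row rather than being dropped: the row space is still the span of
    the forms in [B], and the size does not depend on [B]. *)
Definition pattern_mx {F : fieldType} {T : finType} {n : nat}
    (a : T -> 'rV[F]_n.+1) (B : {set T}) : 'M[F]_(#|T|, n.+1) :=
  \matrix_(i < #|T|) (if enum_val i \in B then a (enum_val i) else 0).

Lemma row_pattern_mx {F : fieldType} {T : finType} {n : nat}
    (a : T -> 'rV[F]_n.+1) (B : {set T}) (t : T) :
  t \in B -> (a t <= pattern_mx a B)%MS.
Proof.
move=> tB; have := row_sub (enum_rank t) (pattern_mx a B).
by rewrite rowK enum_rankK tB.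
Qed.

Lemma pattern_mx_sub {F : fieldType} {T : finType} {n : nat}
    (a : T -> 'rV[F]_n.+1) (B : {set T}) {m : nat} (M : 'M[F]_(m, n.+1)) :
  {in B, forall t, (a t <= M)%MS} -> (pattern_mx a B <= M)%MS.
Proof.
move=> BM; apply/row_subP => i; rewrite rowK.
by case: ifP => [/BM //|_]; exact: sub0mx.
Qed.

Lemma pattern_mx_basis {F : fieldType} {T : finType} {n : nat}
    (a : T -> 'rV[F]_n.+1) (Z : {set T}) :
  exists B : {set T},
    (pattern_mx a B == pattern_mx a Z)%MS && (#|B| == \rank (pattern_mx a Z)).
Proof.
pose f := maxrankfun (pattern_mx a Z).
(* The rows selected by [f] are free, so they have a right inverse. A selected index outside [Z]
   would give a zero row, hence [0 = 1] on the diagonal of the product. *)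
have fZ i : enum_val (f i) \in Z.
  apply/negPn/negP => nZ.
  have /row_freeP[M /(congr1 (row i))] := maxrowsub_free (pattern_mx a Z).
  rewrite row_mul row_rowsub -/f rowK (negPf nZ) mul0mx => /rowP /(_ i) /eqP.
  by rewrite !mxE eqxx eq_sym oner_eq0.
exists [set enum_val (f i) | i : 'I_(\rank (pattern_mx a Z))].
apply/andP; split; last first.
  rewrite card_imset ?card_ord // => i j /enum_val_inj.
  exact: maxrankfun_inj.
apply/andP; split.
  by apply: pattern_mx_sub => _ /imsetP[i _ ->]; exact: row_pattern_mx.
rewrite -(eq_maxrowsub (pattern_mx a Z)); apply/row_subP => i.
by rewrite row_rowsub -/f rowK fZ; apply: row_pattern_mx; exact: imset_f.
Qed.

Lemma mul_pattern_mx_zero_pattern {F : fieldType} {T : finType} {n : nat}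
    (a : T -> 'rV[F]_n.+1) (u : 'cV[F]_n.+1) :
  pattern_mx a (zero_pattern a u) *m u = 0.
Proof.
apply/row_matrixP => i; rewrite row_mul rowK row0.
by case: ifP => [|_]; rewrite ?mul0mx // inE => /eqP.
Qed.

(** The matrix kills [u], so its rank plus that of [u] is at most [n.+1], and a nonzero column has
    positive rank. *)
Lemma rank_zero_pattern {F : fieldType} {T : finType} {n : nat}
    (a : T -> 'rV[F]_n.+1) (u : 'cV[F]_n.+1) :
  u != 0 -> (\rank (pattern_mx a (zero_pattern a u)) <= n)%N.
Proof.
move=> u0; rewrite -ltnS.
apply: leq_trans (mulmx0_rank_max (mul_pattern_mx_zero_pattern a u)).
by rewrite -addn1 leq_add2l lt0n mxrank_eq0.
Qed.

(** A form in the span of forms vanishing at [v] vanishes at [v] too. Used in both directions, this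
    recovers a pattern from its span. *)
Lemma zero_pattern_subset {F : fieldType} {T : finType} {n : nat}
    (a : T -> 'rV[F]_n.+1) (u v : 'cV[F]_n.+1) :
  (pattern_mx a (zero_pattern a u) <= pattern_mx a (zero_pattern a v))%MS ->
  zero_pattern a u \subset zero_pattern a v.
Proof.
move=> suv; apply/fintype.subsetP => t /(row_pattern_mx a) /submx_trans /(_ suv).
by case/submxP => M eqM; rewrite inE eqM -mulmxA mul_pattern_mx_zero_pattern mulmx0.
Qed.

Lemma card_zero_patterns {F : fieldType} {T : finType} {n : nat}
    (a : T -> 'rV[F]_n.+1) (S : {set {set T}}) :
  {in S, forall Z, exists2 u, u != 0 & Z = zero_pattern a u} ->
  (#|S| <= \sum_(0 <= i < n.+1) 'C(#|T|, i))%N.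
Proof.
move=> Spat; rewrite -card_subsets_leq.
pose basis Z := xchoose (pattern_mx_basis a Z).
have basisP Z := xchooseP (pattern_mx_basis a Z).
rewrite -(card_in_imset (f := basis) (D := S)) => [|Z Z' SZ SZ' eqB].
  apply/subset_leq_card/fintype.subsetP => _ /imsetP[Z /Spat[u u0 ->] ->].
  rewrite inE; have /andP[_ /eqP ->] := basisP (zero_pattern a u).
  exact: rank_zero_pattern.
have [/andP[/andP[sBZ sZB] _] /andP[/andP[sBZ' sZB'] _]] := (basisP Z, basisP Z').
rewrite -!/(basis _) eqB in sBZ sZB sBZ' sZB'.
have [[u _ eqZ] [v _ eqZ']] := (Spat _ SZ, Spat _ SZ').
rewrite {}eqZ {}eqZ' in sBZ sZB sBZ' sZB' *.
by apply/eqP; rewrite finset.eqEsubset !zero_pattern_subset //;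
  [exact: submx_trans sZB' sBZ | exact: submx_trans sZB sBZ'].
Qed.

(** Exhibits evaluation of a derivative as a linear form in the coefficients, whose own coefficients
    do not depend on [P]. *)
Lemma derivn_horner_row {K : fieldType} (n j : nat) (P : {poly K}) (x : K) :
  (size P <= n)%N ->
  (P^`(j)).[x] = \sum_(k < n) ('X^k)^`(j).[x] * P`_k.
Proof.
move=> szP; rewrite -[in LHS](coefK P) (poly_def (size P)).
rewrite (big_ord_widen n (fun k => P`_k *: 'X^k) szP) /=.
rewrite big_mkcond raddf_sum horner_sum; apply: eq_bigr => k _ /=.
case: ltnP => [_|szk]; first by rewrite derivnZ hornerZ mulrC.
by rewrite nth_default // mulr0 raddf0 horner0.
Qed.

(** This derivative is the constant [n!] times the leading coefficient, nonzero in characteristic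
    0. *)
Lemma derivn_size_horner_neq0 {K : numFieldType} (n : nat) (P : {poly K}) (x : K) :
  size P = n.+1 -> (P^`(n)).[x] != 0.
Proof.
move=> szP; rewrite (_ : P^`(n) = (lead_coef P *+ n`!)%:P).
  by rewrite hornerC mulrn_eq0 negb_or -lt0n fact_gt0 lead_coef_eq0 -size_poly_eq0 szP.
apply/polyP => i; rewrite coef_derivn coefC lead_coefE szP /=.
case: i => [|i]; first by rewrite addn0 ffactnn.
by rewrite nth_default ?mul0rn // szP addnS ltnS leq_addr.
Qed.

Lemma card_dope_matrices {R : realType} (m n : nat) (Lambda : m.-tuple R[i]) :
  (#|dope_matrices n Lambda| <= \sum_(0 <= i < n.+1) 'C(m * n, i))%N.
Proof.
pose T := ('I_m * 'I_n)%type.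
pose a (t : T) : 'rV[R[i]]_n.+1 :=
  \row_(k < n.+1) ('X^k)^`(t.2).[tnth Lambda t.1].
pose zeros (D : 'M[bool]_(m, n.+1)) : {set T} :=
  [set t | D t.1 (widen_ord (leqnSn n) t.2)].
(* The last column is the same for all dope matrices, so [zeros] may forget it and stay injective;
   this leaves [m * n] forms instead of [m * n.+1]. *)
have last0 D i : D \in dope_matrices n Lambda -> D i ord_max = false.
  rewrite inE => /asboolP[P [szP ->]]; rewrite mxE.
  exact/negbTE/derivn_size_horner_neq0.
have -> : (m * n)%N = #|{: T}| by rewrite card_prod !card_ord.
rewrite -(card_in_imset (f := zeros) (D := dope_matrices n Lambda)) => [|D D' DD DD' /setP eqD].
  apply: (card_zero_patterns a) => _ /imsetP[D DD ->].
  move: DD; rewrite inE => /asboolP[P [szP ->]].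
  exists (\col_k P`_k).
    (* The last entry of the coefficient vector is the leading coefficient of [P]. *)
    apply/eqP => /colP /(_ ord_max) /eqP; rewrite !mxE /=.
    by rewrite -[n in P`_n]/(n.+1.-1) -szP -lead_coefE lead_coef_eq0 -size_poly_eq0 szP.
  apply/setP => t; rewrite !inE mxE (derivn_horner_row n.+1) ?szP //.
  rewrite [a t *m _]mx11_scalar fmorph_eq0 mxE.
  by congr (_ == _); apply: eq_bigr => k _; rewrite !mxE.
apply/matrixP => i j; have [jn|] := ltnP j n.
  by have := eqD (i, Ordinal jn); rewrite !inE /= (_ : widen_ord _ _ = j) //; exact: val_inj.
move=> nj; rewrite (_ : j = ord_max) ?last0 //.
by apply/val_inj/eqP; rewrite eqn_leq nj -ltnS ltn_ord.
Qed.

(** For [i <= n], trading factors [p] for the larger [1 - p] turns the common weight into the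
    binomial weight of index [i]; the terms with [i > n] are nonnegative. *)
Lemma sum_bin_le {R : realFieldType} (p : R) (n N : nat) :
  0 < p -> p <= 1 - p -> (n <= N)%N ->
  (\sum_(0 <= i < n.+1) 'C(N, i))%N%:R * (p ^+ n * (1 - p) ^+ (N - n)) <= 1.
Proof.
move=> p0 pq nN; have q0 : 0 < 1 - p by exact: lt_le_trans pq.
rewrite big_mkord natr_sum mulr_suml.
rewrite [leRHS](_ : 1 = \sum_(i < N.+1) (1 - p) ^+ (N - i) * p ^+ i *+ 'C(N, i)); last first.
  by rewrite -exprDn subrK expr1n.
rewrite (big_ord_widen N.+1 (fun i => 'C(N, i)%:R * (p ^+ n * (1 - p) ^+ (N - n)))) //.
rewrite big_mkcond; apply: ler_sum => i _ /=.
have nneg k l : 0 <= p ^+ k * (1 - p) ^+ l by rewrite mulr_ge0 ?exprn_ge0 ?ltW.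
case: ltnP => [|_]; last by rewrite mulrn_wge0 // mulrC.
rewrite ltnS => lein; rewrite mulr_natl lerMn2r; apply/orP; right.
(* Cancelling [p ^+ i], then [(1 - p) ^+ (N - n)], leaves [p ^+ (n - i) <= (1 - p) ^+ (n - i)]. *)
rewrite -{1}(subnKC lein) exprD -mulrA [leRHS]mulrC ler_wpM2l ?exprn_ge0 ?(ltW p0) //.
have -> : (N - i = (n - i) + (N - n))%N by rewrite addnC addnBA // subnK.
rewrite exprD.
by rewrite ler_wpM2r ?exprn_ge0 ?(ltW q0) // lerXn2r // nnegrE ltW.
Qed.

(** The [ln 2] from base 2 cancels those in [log2], and [N * p = n] turns the exponent into
    [- n * ln p - (N - n) * ln (1 - p)]. *)
Lemma powR2_binary_entropy {R : realType} (p : R) (n N : nat) :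
  0 < p < 1 -> (n <= N)%N -> N%:R * p = n%:R ->
  2 `^ (N%:R * binary_entropy p) = (p ^+ n * (1 - p) ^+ (N - n))^-1.
Proof.
move=> /andP[p0 p1] nN Np; have q0 : 0 < 1 - p by rewrite subr_gt0.
have ln2 : ln 2 != 0 :> R by rewrite gt_eqF // ln_gt0 // ltr1n.
rewrite /powR pnatr_eq0 /= /binary_entropy /log2.
have XE x k : 0 < x -> x ^+ k = expR (k%:R * ln x) :> R.
  by move=> x0; rewrite expRM_natl lnK.
rewrite !XE // -expRD -expRN natrB // -Np.
by congr expR; field.
Qed.

Theorem theorem1p5 (R : realType) (m n : nat) (hm : (3 <= m)%N) :
  (forall Lambda : m.-tuple R[i], uniq Lambda ->
     (#|dope_matrices n Lambda| <= \sum_(0 <= i < n.+1) 'C(m * n, i))%N) /\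
  ((\sum_(0 <= i < n.+1) 'C(m * n, i))%N%:R
     <= 2 `^ (m%:R * n%:R * binary_entropy (1 / m%:R)) :> R).
Proof.
split=> [Lambda _|]; first exact: card_dope_matrices.
have m3 : 3%:R <= m%:R :> R by rewrite ler_nat.
have m0 : 0 < m%:R :> R by lra.
have p0 : 0 < 1 / m%:R :> R by rewrite divr_gt0.
have p2 : 1 / m%:R <= 2^-1 :> R by rewrite div1r lef_pV2 ?posrE //; lra.
have nmn : (n <= m * n)%N by rewrite leq_pmull // (leq_trans _ hm).
(* Here [N = m * n] and [p = 1 / m], so that [N * p = n]; the bound [p <= 1 / 2] gives the
   [p <= 1 - p] needed for [sum_bin_le]. *)
rewrite -natrM (powR2_binary_entropy _ n) //; first last.
- by rewrite natrM; field; rewrite gt_eqF.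
- by rewrite p0 /=; lra.
rewrite -[leRHS]div1r ler_pdivlMr ?sum_bin_le //; first by lra.
by rewrite mulr_gt0 ?exprn_gt0 //; lra.
Qed.
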